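(* Let $N$ be a network and $X\subseteq\Phi(N)$ any set of formulas, and let ${\cal P}_0$ be the protocol over $N$ constructed from $N$ and $X$ as described in the context. For any sets of channels $A,B\subseteq Ch(N)$, if $X\vdash_N A\rhd B$, then $A$ functionally determines $B$ with respect to ${\cal P}_0$.
   Context: A network $N$ is a finite undirected graph (loops and multiple edges allowed) whose vertices are parties and whose edges, called channels, are labeled by secret variables; $Ch(N)$ is the set of channels and $Inc(p)$ the set of channels incident with party $p$. A semi-protocol over $N$ assigns to each channel $c$ a set $V(c)$ of values and to each party $p$ a predicate $L_p$ on the values of the channels in $Inc(p)$; a run is a function $r$ with $r(c)\in V(c)$ for all $c$ satisfying all $L_p$; a protocol is a semi-protocol with at least one run. $A$ functionally determines $B$ w.r.t. a protocol if any two runs agreeing on all channels of $A$ agree on all channels of $B$. A path is a sequence of channels forming an undirected walk; $G$ is a gateway between $A$ and $B$ if every path starting in $A$ and ending in $B$ contains a channel of $G$. $\Phi(N)$ is the smallest set of formulas containing $A\rhd B$ for finite sets of channels $A,B$, the constant $\bot$, and closed under $\to$. The Logic of Secrets for $N$: propositional tautologies, Modus Ponens, and axioms Reflexivity ($A\rhd B$ if $A\supseteq B$), Augmentation ($A\rhd B\to A\cup C\rhd B\cup C$), Transitivity ($A\rhd B\to(B\rhd C\to A\rhd C)$), Gateway ($A\rhd B\to G\rhd B$ if $G$ is a gateway between $A$ and $B$ in $N$); $X\vdash_N\psi$ means derivability from $X$. For $E\subseteq Ch(N)$ let $E^*=\{c\in Ch(N): X\vdash_N E\rhd\{c\}\}$.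 Protocol ${\cal P}_0$: for each channel $c$, $V(c)$ is the set of functions $f:2^{Ch(N)}\to\{0,1\}$ such that $f(E)=0$ whenever $c\in E^*$; writing $r(c,E)$ for $r(c)(E)$, the local condition at party $p$ is: for all $E\subseteq Ch(N)$ and all $c,d\in Inc(p)\setminus E^*$, $r(c,E)=r(d,E)$. (The constant-zero assignment is a run, so ${\cal P}_0$ is a protocol.) *)

(* Defs.v *)
From mathcomp Require Import all_boot.
From mathcomp Require Import boolp.

Set Implicit Arguments.
Unset Strict Implicit.
Unset Printing Implicit Defensive.

(* Undirected multigraph: [endpoints c = (u, v)] says that c joins u and v.
   The order of the pair is an artefact of the encoding, never used below;
   a loop has u = v. *)
Record network := Network {
  party : finType;
  channel : finType;
  endpoints : channel -> party * party }.

Section Graph.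
Variable N : network.
Implicit Types (c : channel N) (p u v : party N) (A B G : {set channel N}).

Definition joins c u v : bool :=
  (endpoints c == (u, v)) || (endpoints c == (v, u)).

Definition Inc p : {set channel N} :=
  [set c | ((endpoints c).1 == p) || ((endpoints c).2 == p)].

(* [walk u s]: the channels of s can be traversed in order starting from u. *)
Fixpoint walk u (s : seq (channel N)) : bool :=
  if s is c :: s' then [exists v, joins c u v && walk v s'] else true.

(* A path has at least one channel, so it is written c :: s. *)
Definition is_path (s : seq (channel N)) : bool :=
  (s != [::]) && [exists u, walk u s].

Definition gateway G A B : Prop :=
  forall c (s : seq (channel N)),
    is_path (c :: s) -> c \in A -> last c s \in B ->
    exists2 g, g \in c :: s & g \in G.

End Graph.

Section Protocols.
Variable N : network.

(* [local p] only sees the values of the channels incident with p. *)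
Record semi_protocol := SemiProtocol {
  value : channel N -> Type;
  local : forall p : party N,
    (forall c : {c : channel N | c \in Inc p}, value (val c)) -> Prop }.

Definition is_run (P : semi_protocol) (r : forall c, value P c) : Prop :=
  forall p : party N, @local P p (fun c => r (val c)).

Record protocol := Protocol {
  semi :> semi_protocol;
  has_run : exists r : forall c, value semi c, is_run r }.

Definition functionally_determines (P : protocol) (A B : {set channel N})
    : Prop :=
  forall r1 r2 : forall c, value P c, is_run r1 -> is_run r2 ->
    (forall a, a \in A -> r1 a = r2 a) -> forall b, b \in B -> r1 b = r2 b.

End Protocols.

Section Logic.
Variable N : network.
Implicit Types A B C G : {set channel N}.

Inductive formula : Type :=
| Det (A B : {set channel N})
| Bot
| Imp (phi psi : formula).

Fixpoint eval (v : {set channel N} -> {set channel N} -> bool) (phi : formula)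
    : bool :=
  match phi with
  | Det A B => v A B
  | Bot => false
  | Imp phi psi => eval v phi ==> eval v psi
  end.

(* The atoms [Det A B] are treated as independent propositional variables. *)
Definition tautology (phi : formula) : Prop := forall v, eval v phi.

Inductive derivable (X : formula -> Prop) : formula -> Prop :=
| Hypothesis_rule phi : X phi -> derivable X phi
| Tautology phi : tautology phi -> derivable X phi
| Modus_ponens phi psi :
    derivable X phi -> derivable X (Imp phi psi) -> derivable X psi
| Reflexivity A B : B \subset A -> derivable X (Det A B)
| Augmentation A B C :
    derivable X (Imp (Det A B) (Det (A :|: C) (B :|: C)))
| Transitivity A B C :
    derivable X (Imp (Det A B) (Imp (Det B C) (Det A C)))
| Gateway A B G :
    gateway G A B -> derivable X (Imp (Det A B) (Det G B)).

End Logic.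

Arguments Bot {N}.

Section P0.
Variables (N : network) (X : formula N -> Prop).
Implicit Types (c d : channel N) (E : {set channel N}).

Definition star E : {set channel N} :=
  [set c | `[< derivable X (Det E [set c]) >]].

Definition P0_value c : Type :=
  {f : {ffun {set channel N} -> bool} |
    [forall E : {set channel N}, (c \in star E) ==> (f E == false)]}.

Definition P0_local (p : party N)
    (r : forall c : {c : channel N | c \in Inc p}, P0_value (val c)) : Prop :=
  forall E (c d : {c : channel N | c \in Inc p}),
    val c \notin star E -> val d \notin star E ->
    val (r c) E = val (r d) E.

Definition P0_semi : semi_protocol N := SemiProtocol P0_local.

Lemma P0_has_run : exists r : forall c, value P0_semi c, is_run r.
Proof.
have zeroP c : [forall E : {set channel N},
    (c \in star E) ==> ([ffun _ : {set channel N} => false] E == false)].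
  by apply/forallP => E; apply/implyP => _; rewrite ffunE.
by exists (fun c => Sub [ffun=> false] (zeroP c) : P0_value c) => p E c d _ _; rewrite /= !ffunE.
Qed.

Definition P0 : protocol N := Protocol P0_has_run.

End P0.

(* Main.v *)
(** If two runs agree on [A] but differ at a channel [b] of [B] in coordinate
    [E], then [b] is outside [star E], and every path from [A] to [b] meets
    [star E], because a run is constant in coordinate [E] along a path avoiding
    [star E]. So [star E] is a gateway between [A] and [b]; since [E] determines
    [star E], it determines [b], contradicting [b] outside [star E]. *)
Require Import Defs.
From mathcomp Require Import all_boot.
From mathcomp Require Import boolp.

Set Implicit Arguments.
Unset Strict Implicit.
Unset Printing Implicit Defensive.

Section Soundness.
Variables (N : network) (X : formula N -> Prop).
Implicit Types (c d : channel N) (A B C D E G : {set channel N}).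

Lemma derivable_trans A B C :
  derivable X (Det A B) -> derivable X (Det B C) -> derivable X (Det A C).
Proof.
move=> dAB; move/Modus_ponens; apply.
exact: Modus_ponens dAB (Transitivity _ _ _ _).
Qed.

(** Augment [Det E C] by [E] and [Det E D] by [C], then chain through [C :|: E]. *)
Lemma derivable_union E C D :
  derivable X (Det E C) -> derivable X (Det E D) ->
  derivable X (Det E (C :|: D)).
Proof.
move=> dC dD.
have dEC := Modus_ponens dC (Augmentation X E C E).
have dCD := Modus_ponens dD (Augmentation X E D C).
rewrite setUid in dEC; rewrite setUC [D :|: C]setUC in dCD.
exact: derivable_trans dEC dCD.
Qed.

(** As there are finitely many channels, the singletons can be joined one at a time, starting from
    the empty set. *)
Lemma derivable_star E : derivable X (Det E (star X E)).
Proof.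
have -> : star X E = \bigcup_(c in star X E) [set c].
  apply/setP => c; apply/idP/bigcupP => [cE|[d dE /set1P ->] //].
  by exists c; rewrite ?set11.
elim/big_rec: _ => [|c D cE dD]; first exact/Reflexivity/sub0set.
by apply: derivable_union dD; move: cE; rewrite inE => /asboolP.
Qed.

Lemma joins_Inc c (u v : party N) : joins c u v -> (c \in Inc u) && (c \in Inc v).
Proof. by rewrite !inE => /orP[] /eqP -> /=; rewrite !eqxx !orbT. Qed.

(** Consecutive channels share a party, whose local condition equates their values at [E], both
    being outside [star X E]. *)
Lemma run_constant_on_walk E (r : forall c, value (P0 X) c)
    (u : party N) c (s : seq (channel N)) :
  is_run r -> walk u (c :: s) -> ~~ has (mem (star X E)) (c :: s) ->
  val (r c) E = val (r (last c s)) E.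
Proof.
move=> run_r; elim: s c u => [|d s IHs] c u //=.
move=> /existsP[v /andP[/joins_Inc /andP[_ cv] walk_v]].
rewrite !negb_or => /and3P[cE dE sE].
have dv : d \in Inc v.
  by case/existsP: walk_v => w /andP[/joins_Inc /andP[]].
transitivity (val (r d) E).
  exact: (run_r v E (Sub c cv) (Sub d dv)).
by apply: IHs walk_v _; rewrite /= negb_or dE.
Qed.

Lemma P0_value_star E c (f : P0_value X c) : c \in star X E -> val f E = false.
Proof. by move=> cE; move/forallP/(_ E)/implyP/(_ cE)/eqP: (valP f). Qed.

End Soundness.

Theorem theorem8 (N : network) (X : formula N -> Prop)
    (A B : {set channel N}) :
  derivable X (Det A B) -> functionally_determines (P0 X) A B.
Proof.
move=> dAB r1 r2 run1 run2 r12 b bB.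
apply/val_inj/ffunP => E.
have [bE|bE] := boolP (b \in star X E); first by rewrite !P0_value_star.
apply/eqP; apply: contraNT bE => r12b.
have gate : gateway (star X E) A [set b].
  move=> c s /andP[_ /existsP[u walk_u]] cA /set1P last_b.
  (* Along a path avoiding [star X E], the difference at [b] would carry back to [c], where the runs
     agree. *)
  apply/hasP; apply: contraNT r12b => avoid.
  rewrite -last_b -(run_constant_on_walk run1 walk_u avoid).
  by rewrite -(run_constant_on_walk run2 walk_u avoid) r12.
have dAb : derivable X (Det A [set b]).
  by apply: derivable_trans dAB _; apply: Reflexivity; rewrite sub1set.
rewrite inE; apply/asboolP; apply: derivable_trans (derivable_star X E) _.
exact: Modus_ponens dAb (Gateway _ gate).
Qed.
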